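(* Let $\alpha\in(0,1)$ and let $k\ge 1$ be an integer. Let $(P_i)_{i\ge 0}$ be an $\alpha$-random walk in $\mathbb{Z}^2$ starting at the origin, and for $i\ge 1$ let $X_i=1$ if $P_i$ is $k$-free and $X_i=0$ otherwise. For $n\ge 1$ put $$\overline{S}_n=\frac{X_1+X_2+\cdots+X_n}{n}.$$ Then $$\lim_{n\to+\infty}\overline{S}_n=\frac{1}{\zeta(2k)}$$ almost surely, where $\zeta$ is the Riemann zeta function.
   Context: For an integer $k\ge 1$, a positive integer is $k$-free if it is not divisible by $p^k$ for any prime $p$ (so the only $1$-free positive integer is $1$). A non-zero lattice point $(m,n)\in\mathbb{Z}^2$ is $k$-free if $\gcd(m,n)$ is $k$-free. For $0<\alpha<1$, an $\alpha$-random walk starting at the origin is the sequence of random points $P_0=(0,0)$ and $P_{i+1}=P_i+\xi_{i+1}$ for $i=0,1,2,\dots$, where the steps $\xi_1,\xi_2,\dots$ are independent, each equal to $(1,0)$ with probability $\alpha$ and to $(0,1)$ with probability $1-\alpha$. *)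

(* Defs.v *)
From HB Require Import structures.
From mathcomp Require Import all_boot all_order all_algebra finmap.
From mathcomp Require Import all_classical all_reals all_analysis.

Set Implicit Arguments.
Unset Strict Implicit.
Unset Printing Implicit Defensive.

Import Order.TTheory GRing.Theory Num.Theory.
Import numFieldNormedType.Exports.

Local Open Scope classical_set_scope.
Local Open Scope ring_scope.

(* The integers carry the discrete sigma-algebra, hence [int * int] the product
   of two discrete ones: every subset of the lattice is measurable. *)
HB.instance Definition _ := isPointed.Build int 0.
HB.instance Definition _ := @isMeasurable.Build default_measure_display
  int discrete_measurable discrete_measurable0
  discrete_measurableC discrete_measurableU.

Definition mutually_independent (d d' : measure_display) (T : measurableType d)
    (T' : measurableType d') (R : realType) (P : probability T R)
    (I : choiceType) (X : I -> {RV P >-> T'}) : Prop :=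
  forall (J : {fset I}) (A : I -> set T'), (forall i, measurable (A i)) ->
    P (\bigcap_(i in [set` J]) (X i @^-1` A i))
    = (\prod_(i <- J) P (X i @^-1` A i))%E.
Arguments mutually_independent {d d' T T' R} P {I} X.

(* Positivity of [m] is automatic: 0 is divisible by every [p ^ k]. *)
Definition kfree (k m : nat) : Prop :=
  forall p : nat, prime p -> ~~ (p ^ k %| m)%N.

Definition kfree_point (k : nat) (v : int * int) : Prop :=
  v != 0 /\ kfree k `|gcdz v.1 v.2|%N.

(* [xi i] is the [i.+1]-st step of the walk. *)
Fixpoint walk (T : Type) (xi : nat -> T -> int * int) (i : nat) (t : T) :
    int * int :=
  if i is j.+1 then walk xi j t + xi j t else 0.

Definition alpha_steps (d : measure_display) (T : measurableType d)
    (R : realType) (P : probability T R) (alpha : R)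
    (xi : nat -> {RV P >-> (int * int)%type}) : Prop :=
  mutually_independent P xi /\
  forall i, P [set t | xi i t = (1, 0)] = alpha%:E /\
            P [set t | xi i t = (0, 1)] = (1 - alpha)%:E.
Arguments alpha_steps {d T R} P alpha xi.

Definition visit_indicator (R : realType) (T : Type) (k : nat)
    (W : nat -> T -> int * int) (i : nat) (t : T) : R :=
  \1_[set v | kfree_point k v] (W i t).

Definition visit_average (R : realType) (T : Type) (k : nat)
    (W : nat -> T -> int * int) (n : nat) (t : T) : R :=
  (\sum_(1 <= i < n.+1) visit_indicator R k W i t) / n%:R.

(* Meaningful for [1 < s], where the Dirichlet series converges. *)
Definition zeta (R : realType) (s : R) : R :=
  limn (series (fun n : nat => n.+1%:R `^ (- s))).

(* Main.v *)
Require Import Defs.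
From mathcomp Require Import all_boot all_order all_algebra finmap.
From mathcomp Require Import all_classical all_reals all_analysis.
From mathcomp Require Import measurable_realfun.
From mathcomp Require Import ring lra zify.
Import Order.TTheory GRing.Theory Num.Theory.
Import numFieldNormedType.Exports.
Local Open Scope classical_set_scope.
Local Open Scope ring_scope.

Set Implicit Arguments.
Unset Strict Implicit.
Unset Printing Implicit Defensive.

(** Almost surely the walk at time [i] is [(S, i - S)], where [S] is the
    number of east steps among the first [i], and the gcd of its coordinates
    is [gcdn S i]. By Moebius inversion the visit indicator is the sum of
    [moebius d] over the [d] such that [d ^ k] divides both [i] and [S]
    ([sum_moebius_kfree], [kfree_gcdE]).

    The probabilistic input is that the number of heads in [h] tosses is
    equidistributed modulo every [q], with an error [O(1 / sqrt h)] that
    does not depend on [q] ([toss_mean_dvdn]); it comes from Stein's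
    identity for the binomial law applied to a sawtooth function. Hence,
    given the walk up to time [i - h], the visit indicator at time [i] has
    mean close to a deterministic number [g_i] ([kfree_density]), the sum of
    [moebius d / d ^ k] over the [d] with [d ^ k %| i], and the error is
    [O(1 / sqrt h)] times the number of those [d] ([toss_mean_kfree_gcd]).
    Visits more than [h] steps apart are thus almost uncorrelated, which
    bounds the second moment of the sum of the fluctuations
    ([second_moment_total_fluctuation]). For [n = M ^ 8] and [h = M ^ 6] the
    second moment of the averaged fluctuation is [O(M ^ -2)]
    ([second_moment_eighth_power]). This is summable over [M], so the
    averages tend to [0] almost surely along eighth powers
    ([ae_cvg0_of_toss_mean]), and along all [n] because the fluctuations are
    bounded ([sparse_means_cvg0]).

    It remains to average the numbers [g_i]. Exchanging sums, their mean
    tends to the sum of [moebius d / d ^ (2 * k)] by Tannery's theorem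
    ([cvg_mean_kfree_density]). This series is the reciprocal of the zeta
    value: the partial sums of the product of the two Dirichlet series over
    [d * e <= n] are all equal to [1] ([lim_series_moebius]). *)

(** * Moebius function and k-free integers *)

Definition moebius (n : nat) : int :=
  if all (fun p => logn p n == 1%N) (primes n) then (-1) ^+ size (primes n)
  else 0.

Lemma norm_moebius_le1 n : `|moebius n| <= 1.
Proof.
rewrite /moebius; case: ifP => _; last by rewrite normr0.
by rewrite normrX normrN1 expr1n.
Qed.

Lemma moebius_square p d : prime p -> (0 < d)%N -> (p ^ 2 %| d)%N ->
  moebius d = 0.
Proof.
move=> pp d0 pd; rewrite /moebius; case: ifP => // /allP h.
have pd1 : (p %| d)%N by apply: dvdn_trans pd; rewrite dvdn_exp.
have : p \in primes d by rewrite mem_primes pp d0.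
by move/h; move: pd; rewrite pfactor_dvdn // => + /eqP h1; rewrite h1.
Qed.

Lemma moebius_mulp p e : prime p -> (0 < e)%N -> ~~ (p %| e)%N ->
  moebius (p * e) = - moebius e.
Proof.
move=> pp e0 npe; have p0 := prime_gt0 pp.
have hp : perm_eq (primes (p * e)) (p :: primes e).
  apply: uniq_perm; rewrite /= ?primes_uniq ?andbT //.
    by rewrite mem_primes pp e0.
  move=> q; rewrite inE primesM // primes_prime // inE.
  by [].
rewrite /moebius (perm_all _ hp) (perm_size hp) /= lognM //.
rewrite (logn_prime _ pp) eqxx lognE (negbTE npe) !andbF addn0 /=.
have -> : all (fun q => logn q (p * e) == 1%N) (primes e) =
    all (fun q => logn q e == 1%N) (primes e).
  apply: eq_in_all => q; rewrite mem_primes => /andP[pq /andP[_ qe]].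
  rewrite lognM // (logn_prime _ pp); case: (eqVneq q p) => [qp|_] //.
  by move: npe; rewrite -qp qe.
by case: ifP; rewrite ?oppr0 // exprS mulN1r.
Qed.

(** Fix a prime [p] dividing [n].  Only divisors free of [p ^ 2] contribute, and
    [e |-> p * e] matches those prime to [p] with those divisible by [p] while
    changing the sign of [moebius]. *)
Lemma sum_moebius_divisors n : (0 < n)%N ->
  \sum_(d <- divisors n) moebius d = (n == 1)%N%:R.
Proof.
move=> n0; have [->|n1] := eqVneq n 1%N.
  by rewrite (_ : divisors 1 = [:: 1%N]) // big_seq1.
have {n1} n1 : (1 < n)%N by case: n n0 n1 => [|[|]].
pose p := pdiv n; have pp : prime p := pdiv_prime n1.
have pn : (p %| n)%N := pdiv_dvd n.
have mem d : d \in divisors n -> (0 < d)%N.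
  by rewrite -dvdn_divisors //; apply: dvdn_gt0.
rewrite (bigID (fun d => p ^ 2 %| d)%N) /= big_seq_cond big1 ?add0r; last first.
  by move=> d /andP[/mem d0 pd]; apply: moebius_square pd.
rewrite (bigID (fun d => p %| d)%N) /=.
have -> : \sum_(d <- divisors n | ~~ (p ^ 2 %| d)%N && ~~ (p %| d)%N) moebius d
    = \sum_(d <- divisors n | ~~ (p %| d)%N) moebius d.
  apply: eq_bigl => d; case: (boolP (p %| d)%N) => h; first by rewrite andbF.
  by rewrite andbT; apply: contra h; apply: dvdn_trans; rewrite dvdn_exp.
rewrite -big_filter.
have hp : perm_eq
    [seq d <- divisors n | ~~ (p ^ 2 %| d)%N && (p %| d)%N]
    [seq (p * e)%N | e <- [seq e <- divisors n | ~~ (p %| e)%N]].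
  apply: uniq_perm; first by rewrite filter_uniq // divisors_uniq.
    rewrite map_inj_uniq ?filter_uniq ?divisors_uniq //.
    by move=> a b /eqP; rewrite eqn_pmul2l ?prime_gt0 // => /eqP.
  move=> d; rewrite mem_filter -dvdn_divisors //; apply/idP/mapP.
    move=> /andP[/andP[np2 /dvdnP[e de]]]; rewrite de => dn.
    exists e; last by rewrite mulnC.
    have en : (e %| n)%N by apply: dvdn_trans dn; rewrite dvdn_mulr.
    rewrite mem_filter -dvdn_divisors // en andbT.
    by apply: contra np2 => pe; rewrite de expnS expn1 dvdn_mul.
  move=> [e]; rewrite mem_filter -dvdn_divisors // => /andP[npe en] ->.
  rewrite (dvdn_mulr _ (dvdnn p)) andbT expnS expn1.
  rewrite dvdn_pmul2l ?prime_gt0 // npe /=.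
  by rewrite Gauss_dvd ?pn // prime_coprime.
rewrite (perm_big _ hp) big_map big_filter.
rewrite big_seq_cond [X in _ + X]big_seq_cond.
rewrite (eq_bigr (fun d => - moebius d)); last first.
  by move=> d /andP[/mem d0 npd]; rewrite moebius_mulp.
by rewrite sumrN addNr.
Qed.

(** The cutoff [N] is arbitrary so that sums attached to different integers can
    run over a common range and be exchanged. *)
Lemma sum_moebius n N : (0 < n <= N)%N ->
  \sum_(1 <= d < N.+1 | (d %| n)%N) moebius d = (n == 1)%N%:R.
Proof.
move=> /andP[n0 nN]; rewrite -sum_moebius_divisors // -big_filter.
apply: perm_big; apply: uniq_perm; rewrite ?divisors_uniq //.
  by rewrite filter_uniq // iota_uniq.
move=> d; rewrite mem_filter -dvdn_divisors // mem_index_iota.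
case: (boolP (d %| n)%N) => //= dn.
by rewrite (dvdn_gt0 n0 dn) ltnS (leq_trans (dvdn_leq n0 dn)).
Qed.

Lemma dvdn_lcm_exp k a b n :
  (a ^ k %| n)%N -> (b ^ k %| n)%N -> (lcmn a b ^ k %| n)%N.
Proof.
have [->|a0] := posnP a; first by rewrite lcm0n.
move=> an bn; have g0 : (0 < gcdn a b)%N by rewrite gcdn_gt0 a0.
pose a' := (a %/ gcdn a b)%N; pose b' := (b %/ gcdn a b)%N.
have ea : a = (a' * gcdn a b)%N by rewrite divnK ?dvdn_gcdl.
have eb : b = (b' * gcdn a b)%N by rewrite divnK ?dvdn_gcdr.
have cab : coprime a' b'.
  by rewrite /coprime -(eqn_pmul2r g0) muln_gcdl mul1n -ea -eb.
have -> : lcmn a b = (a' * b' * gcdn a b)%N.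
  apply/eqP; rewrite -(eqn_pmul2r g0) muln_lcm_gcd; apply/eqP.
  transitivity ((a' * gcdn a b) * (b' * gcdn a b))%N; first by rewrite -ea -eb.
  by ring.
move: an bn; rewrite [X in (X ^ k %| _)%N -> _]ea.
rewrite [X in _ -> (X ^ k %| _)%N -> _]eb !expnMn => /dvdnP[c ->].
rewrite mulnA !dvdn_pmul2r ?expn_gt0 ?g0 // => bc.
by rewrite Gauss_dvd ?coprimeXl ?coprimeXr // dvdn_mull.
Qed.

(** The integers [d] with [d ^ k %| n] are closed under least common multiples,
    so they are exactly the divisors of the largest of them. *)
Lemma exists_kth_root_divisor k n : (0 < k)%N -> (0 < n)%N ->
  exists2 D, (0 < D)%N & forall d, (d ^ k %| n)%N = (d %| D)%N.
Proof.
move=> k0 n0; pose D := \big[lcmn/1%N]_(d < n.+1 | (d ^ k %| n)%N) d.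
have Dn : (D ^ k %| n)%N.
  rewrite /D; elim/big_ind: _ => [|a b|//]; first by rewrite exp1n dvd1n.
  exact: dvdn_lcm_exp.
have D0 : (0 < D)%N.
  by case: posnP Dn => // ->; rewrite exp0n // dvd0n (gtn_eqF n0).
exists D => // d; apply/idP/idP => [dn|dD].
  have d0 : (0 < d)%N.
    by case: posnP dn => // ->; rewrite exp0n // dvd0n (gtn_eqF n0).
  have dle : (d < n.+1)%N.
    rewrite ltnS (leq_trans _ (dvdn_leq n0 dn)) // -{1}(expn1 d).
    by rewrite leq_pexp2l.
  by rewrite /D (bigD1 (Ordinal dle)) //= dvdn_lcml.
by apply: dvdn_trans Dn; rewrite dvdn_exp2r.
Qed.

(** [n] is [k]-free exactly when the largest [D] with [D ^ k %| n] is [1], and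
    the [d] summed over are the divisors of that [D]. *)
Lemma sum_moebius_kfree k n N : (0 < k)%N -> (0 < n <= N)%N ->
  \sum_(1 <= d < N.+1 | (d ^ k %| n)%N) moebius d = `[< kfree k n >]%:R.
Proof.
move=> k0 /andP[n0 nN]; have [D D0 hD] := exists_kth_root_divisor k0 n0.
have DN : (0 < D <= N)%N.
  rewrite D0 (leq_trans _ nN) //; apply: dvdn_leq => //.
  by apply: (@dvdn_trans (D ^ k)); rewrite ?hD // -{1}(expn1 D) dvdn_exp2l.
rewrite (eq_bigl _ _ hD) (sum_moebius DN); congr (nat_of_bool _)%:R.
apply/eqP/asboolP => [D1 p pp|h].
  by rewrite hD D1 dvdn1 (gtn_eqF (prime_gt1 pp)).
apply/eqP; rewrite eqn_leq D0 andbT leqNgt; apply/negP => D1.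
by have := h _ (pdiv_prime D1); rewrite hD pdiv_dvd.
Qed.

Lemma sum_multiples (V : nmodType) (f : nat -> V) d N : (0 < d)%N ->
  \sum_(1 <= m < N.+1 | (d %| m)%N) f m
  = \sum_(1 <= e < (N %/ d).+1) f (d * e)%N.
Proof.
move=> d0; elim: N => [|N IH]; first by rewrite div0n !big_geq.
rewrite big_mkcond big_nat_recr //= -big_mkcond IH divnS // addnC.
case: (boolP (d %| N.+1)%N) => [/dvdnP[q hq]|_]; last by rewrite addn0 addr0.
rewrite addn1 [RHS]big_nat_recr //=; congr (_ + f _).
have := hq; have := divnS N d0; rewrite hq dvdn_mull // mulnK // add1n => ->.
by rewrite mulnC.
Qed.

(** * Bernoulli tosses and equidistribution modulo d *)

(** Expectation of [F] under [n] independent tosses, heads with probability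
    [a].  Recursion on the first toss makes conditioning on a prefix of the
    tosses a plain unfolding, with no product measure involved. *)
Fixpoint toss_mean (R : realType) (a : R) (n : nat) (F : seq bool -> R) : R :=
  if n is m.+1 then
    a * toss_mean a m (fun s => F (true :: s))
    + (1 - a) * toss_mean a m (fun s => F (false :: s))
  else F [::].

Section TossMean.
Variables (R : realType) (a : R).
Hypotheses (a0 : 0 < a) (a1 : a < 1).
Implicit Types (F G : seq bool -> R) (phi : nat -> R) (n m h b d : nat).
Local Notation E := (toss_mean a).
Local Notation heads := (count id).

Let b0 : 0 < 1 - a. Proof. by rewrite subr_gt0. Qed.

Lemma eq_toss_mean n F G : (forall s, size s = n -> F s = G s) -> E n F = E n G.
Proof.
elim: n F G => [|n IH] F G h /=; first exact: h.
by congr (_ * _ + _ * _); apply: IH => s hs; apply: h; rewrite /= hs.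
Qed.

Lemma toss_meanS n F : E n.+1 F =
  a * E n (fun s => F (true :: s)) + (1 - a) * E n (fun s => F (false :: s)).
Proof. by []. Qed.

Lemma le_toss_mean n F G :
  (forall s, size s = n -> F s <= G s) -> E n F <= E n G.
Proof.
elim: n F G => [|n IH] F G h /=; first exact: h.
by apply: lerD; apply: ler_wpM2l; rewrite ?(ltW a0) ?(ltW b0) //;
   apply: IH => s hs; apply: h; rewrite /= hs.
Qed.

Lemma toss_mean_cst n (c : R) : E n (fun=> c) = c.
Proof. by elim: n => [|n IH] //=; rewrite IH; ring. Qed.

Lemma toss_meanD n F G : E n (fun s => F s + G s) = E n F + E n G.
Proof. by elim: n F G => [|n IH] F G //=; rewrite !IH; ring. Qed.

Lemma toss_meanZ n (c : R) F : E n (fun s => c * F s) = c * E n F.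
Proof. by elim: n F => [|n IH] F //=; rewrite !IH; ring. Qed.

Lemma toss_mean_sum n (I : Type) (r : seq I) (P : pred I)
    (F : I -> seq bool -> R) :
  E n (fun s => \sum_(i <- r | P i) F i s) = \sum_(i <- r | P i) E n (F i).
Proof.
elim: n F => [|n IH] F //=.
by rewrite !IH !mulr_sumr -big_split.
Qed.

(** Conditioning on the first [m] tosses. *)
Lemma toss_mean_cat m n F :
  E (m + n) F = E m (fun s => E n (fun t => F (s ++ t))).
Proof. by elim: m F => [|m IH] F //=; rewrite !IH. Qed.

Lemma toss_mean_take m n F :
  (m <= n)%N -> E n (fun s => F (take m s)) = E m F.
Proof.
move=> mn; rewrite -(subnKC mn) toss_mean_cat; apply: eq_toss_mean => s hs.
by rewrite -[RHS](toss_mean_cst (n - m)); apply: eq_toss_mean => t _;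
   rewrite take_size_cat.
Qed.

Lemma norm_toss_mean_le n F G :
  (forall s, size s = n -> `|F s| <= G s) -> `|E n F| <= E n G.
Proof.
move=> h; rewrite ler_norml; apply/andP; split.
  rewrite lerNl -mulN1r -toss_meanZ; apply: le_toss_mean => s /h.
  by rewrite mulN1r ler_norml lerNl => /andP[].
by apply: le_toss_mean => s /h; rewrite ler_norml => /andP[].
Qed.

(** Stein's identity for the binomial law: a discrete integration by parts that
    trades an increment of [phi] for the centred number of heads, and so gains
    a factor of the order of the square root of [n]. *)
Lemma toss_mean_stein n phi :
  E n.+1 (fun s => ((heads s)%:R - a * n.+1%:R) * phi (heads s))
  = n.+1%:R * (a * (1 - a))
    * (E n (fun s => phi (heads s).+1) - E n (fun s => phi (heads s))).
Proof.
elim: n phi => [|n IH] phi; first by rewrite /=; ring.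
pose Z (psi : nat -> R) :=
  E n.+1 (fun s => ((heads s)%:R - a * n.+1%:R) * psi (heads s)).
have -> : E n.+2 (fun s => ((heads s)%:R - a * n.+2%:R) * phi (heads s)) =
    a * (Z (fun x => phi x.+1) + (1 - a) * E n.+1 (fun s => phi (heads s).+1))
    + (1 - a) * (Z phi + - a * E n.+1 (fun s => phi (heads s))).
  rewrite toss_meanS; congr (_ * _ + _ * _);
    rewrite -toss_meanZ -toss_meanD; apply: eq_toss_mean => s _;
    rewrite /= ?add1n ?add0n -!(natr1, natrM); ring.
have ES psi : E n.+1 (fun s => psi (heads s)) =
    a * E n (fun s => psi (heads s).+1)
    + (1 - a) * E n (fun s => psi (heads s)).
  by [].
rewrite /Z (IH phi) (IH (fun x => phi x.+1)) (ES phi) (ES (fun x => phi x.+1)).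
by rewrite -!natr1; ring.
Qed.

(** Stein's identity for the centred identity function, whose increments are
    all [1]. *)
Lemma toss_mean_variance n :
  E n.+1 (fun s => ((heads s)%:R - a * n.+1%:R) ^+ 2)
  = n.+1%:R * (a * (1 - a)).
Proof.
have := toss_mean_stein n (fun x => x%:R - a * n.+1%:R) => /= ->.
rewrite (eq_toss_mean (G := fun s => 1 + ((heads s)%:R - a * n.+1%:R))).
  by rewrite toss_meanD toss_mean_cst addrK mulr1.
by move=> s _; rewrite -natr1; ring.
Qed.

(** Standard deviation of the number of heads in [h.+1] tosses, the number that
    Stein's identity pairs with increments over [h] tosses. *)
Definition toss_dev h : R := Num.sqrt (h.+1%:R * (a * (1 - a))).

Lemma toss_dev_gt0 h : 0 < toss_dev h.
Proof. by rewrite sqrtr_gt0 !mulr_gt0. Qed.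

(** By Stein's identity the increment is the mean of the centred number of heads
    times [phi], divided by the variance [w ^+ 2]; as [phi] is bounded by [1],
    that mean is at most the mean absolute deviation, hence at most [w]. *)
Lemma toss_mean_increment h phi : (forall x, `|phi x| <= 1) ->
  `|E h (fun s => phi (heads s).+1 - phi (heads s))| <= (toss_dev h)^-1.
Proof.
move=> phi1; have w0 := toss_dev_gt0 h; set w := toss_dev h in w0 *.
have w2 : w ^+ 2 = h.+1%:R * (a * (1 - a)).
  by rewrite sqr_sqrtr // !mulr_ge0 // ltW.
rewrite (eq_toss_mean (G := fun s => phi (heads s).+1 + -1 * phi (heads s)));
  last by move=> s _; rewrite mulN1r.
rewrite toss_meanD toss_meanZ mulN1r -(ler_pM2l (exprn_gt0 2 w0)).
rewrite -[X in X * `|_|]gtr0_norm ?exprn_gt0 // -normrM w2 -toss_mean_stein -w2.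
have -> : w ^+ 2 / w = E h.+1 (fun s =>
    (2 * w)^-1 * ((heads s)%:R - a * h.+1%:R) ^+ 2 + w / 2).
  rewrite toss_meanD toss_mean_cst toss_meanZ toss_mean_variance -w2.
  by field; rewrite gt_eqF.
(* The mean absolute deviation is bounded through |y| <= y^2 / (2 w) + w / 2,
   whose right-hand side has mean w. *)
apply: norm_toss_mean_le => s _; set y := _ - _.
rewrite normrM; apply: (@le_trans _ _ `|y|); first by rewrite ler_piMr.
have -> : (2 * w)^-1 * y ^+ 2 + w / 2 = `|y| + (2 * w)^-1 * (`|y| - w) ^+ 2.
  by rewrite -(real_normK (num_real y)); field; rewrite gt_eqF.
by rewrite lerDl mulr_ge0 ?sqr_ge0 // invr_ge0 mulr_ge0 // ltW.
Qed.

(** Equidistribution of the number of heads modulo [d], with an error that does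
    not depend on [d]: the function [1_(d %| y) - 1 / d] is the increment of the
    sawtooth [ceil (y / d) - y / d], which takes its values in the unit interval
    whatever [d] is. *)
Lemma toss_mean_dvdn h b d : (0 < d)%N ->
  `|E h (fun s => (d %| b + heads s)%N%:R) - d%:R^-1| <= (toss_dev h)^-1.
Proof.
move=> d0; have dR : 0 < d%:R :> R by rewrite ltr0n.
(* (y + d - 1) %/ d is the ceiling of y / d. *)
pose phi x : R := ((b + x + d.-1) %/ d)%N%:R - (b + x)%N%:R / d%:R.
have -> : E h (fun s => (d %| b + heads s)%N%:R) - d%:R^-1 =
    E h (fun s => phi (heads s).+1 - phi (heads s)).
  rewrite -(toss_mean_cst h (- d%:R^-1)) -toss_meanD.
  apply: eq_toss_mean => s _.
  rewrite /phi addnS addSn divnS // -addnS prednK //.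
  rewrite (dvdn_addl _ (dvdnn d)) natrD -natr1.
  by field; rewrite gt_eqF.
apply: toss_mean_increment => x; rewrite /phi; set y := (b + x)%N.
have h1 := leq_trunc_div (y + d.-1) d; have h2 := ltn_ceil (y + d.-1) d0.
set q := (_ %/ d)%N in h1 h2 *.
have l1 : (y <= q * d)%N by move: h2; rewrite mulSn -{1}(prednK d0); lia.
have l2 : (q * d <= y + d)%N by rewrite (leq_trans h1) // leq_add2l leq_pred.
rewrite ger0_norm.
  rewrite lerBlDr -(ler_pM2r dR) mulrDl divfK ?gt_eqF // mul1r.
  by rewrite -natrM -natrD ler_nat addnC.
by rewrite subr_ge0 ler_pdivrMr // -natrM ler_nat.
Qed.

End TossMean.

(** * Second moment of the fluctuations of the visits *)

Section KfreeFluctuation.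
Variables (R : realType) (k : nat).
Hypothesis k0 : (0 < k)%N.
Implicit Types (b d h i j m n r : nat).

Definition kfree_gcd i r : R := `[< kfree k (gcdn r i) >]%:R.

(** Proportion of the residues [r] modulo [i] for which [gcdn r i] is [k]-free;
    it is the value to which the visit probability at time [i] is compared. *)
Definition kfree_density i : R :=
  \sum_(1 <= d < i.+1 | (d ^ k %| i)%N) (moebius d)%:~R / (d ^ k)%N%:R.

Definition num_kth_divisors i : nat := \sum_(1 <= d < i.+1) (d ^ k %| i).

Lemma kfree_gcdE i r : (0 < i)%N -> kfree_gcd i r =
  \sum_(1 <= d < i.+1 | (d ^ k %| i)%N) (moebius d)%:~R * (d ^ k %| r)%N%:R.
Proof.
move=> i0; have gi : (0 < gcdn r i <= i)%N.
  by rewrite gcdn_gt0 i0 orbT dvdn_leq // dvdn_gcdr.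
have := congr1 (intmul 1 : int -> R) (sum_moebius_kfree k0 gi).
rewrite rmorph_sum rmorph_nat /kfree_gcd => <-.
rewrite [RHS](eq_bigr (fun d => if (d ^ k %| r)%N then (moebius d)%:~R else 0)).
  by rewrite -big_mkcondr; apply: eq_bigl => d; rewrite dvdn_gcd andbC.
by move=> d _; case: (_ %| r)%N; rewrite ?mulr1 ?mulr0.
Qed.

Lemma norm_intr_moebius_le1 d : `|(moebius d)%:~R : R| <= 1.
Proof. by rewrite -intr_norm -(mulr1z 1) ler_int norm_moebius_le1. Qed.

(** Each [d ^ k] dividing [i] divides exactly [i / d ^ k] of [1, ..., i]. *)
Lemma kfree_densityE i : (0 < i)%N ->
  kfree_density i = (\sum_(1 <= r < i.+1) kfree_gcd i r) / i%:R.
Proof.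
move=> i0; have iR : i%:R != 0 :> R by rewrite pnatr_eq0 -lt0n.
apply: (mulIf iR); rewrite divfK //.
under [RHS]eq_bigr do rewrite kfree_gcdE //.
rewrite exchange_big /= /kfree_density mulr_suml.
rewrite [LHS]big_nat_cond [RHS]big_nat_cond.
apply: eq_bigr => d /andP[/andP[d0 _] di].
rewrite -mulr_sumr -natr_sum -divn_count_dvd -mulrA; congr (_ * _).
have dR : (d ^ k)%N%:R != 0 :> R by rewrite pnatr_eq0 -lt0n expn_gt0 d0.
by apply: (mulfI dR); rewrite mulVKf // -natrM mulnC divnK.
Qed.

Lemma kfree_density_bounds i : (0 < i)%N -> 0 <= kfree_density i <= 1.
Proof.
move=> i0; rewrite kfree_densityE // divr_ge0 ?sumr_ge0 //=.
rewrite ler_pdivrMr ?ltr0n // mul1r (@le_trans _ _ (\sum_(1 <= r < i.+1) 1)) //.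
  by apply: ler_sum => r _; rewrite /kfree_gcd lern1 leq_b1.
by rewrite sumr_const_nat subSS subn0.
Qed.

(** Exchanging sums, the left-hand side is at most the sum of [n / d], that is
    [n] times a harmonic sum.  The logarithmic loss is affordable,
    since the sum is later divided by the square root of the decorrelation
    time. *)
Lemma sum_num_kth_divisors n : (0 < n)%N ->
  (\sum_(1 <= j < n.+1) num_kth_divisors j)%N%:R <= n%:R * (1 + ln n%:R) :> R.
Proof.
move=> n0; apply: (@le_trans _ _ (\sum_(1 <= d < n.+1) n%:R / d%:R)).
  apply: (@le_trans _ _ (\sum_(1 <= d < n.+1) (n %/ d)%N%:R)).
    rewrite -natr_sum ler_nat.
    under [leqRHS]eq_bigr do rewrite divn_count_dvd.
    rewrite exchange_big /= [leqLHS]big_nat_cond [leqRHS]big_nat_cond.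
    apply: leq_sum => j /andP[/andP[j0 jn] _].
    rewrite /num_kth_divisors (@big_cat_nat _ _ _ j.+1 1 n.+1) //=.
    apply: (@leq_trans (\sum_(1 <= d < j.+1) (d %| j))); last exact: leq_addr.
    apply: leq_sum => d _; case: (boolP (d ^ k %| j)%N) => // dj.
    by rewrite (dvdn_trans _ dj) // -{1}(expn1 d) dvdn_exp2l.
  rewrite [leLHS]big_nat_cond [leRHS]big_nat_cond.
  apply: ler_sum => d /andP[/andP[d0 _] _].
  by rewrite ler_pdivlMr ?ltr0n // -natrM ler_nat leq_trunc_div.
rewrite -mulr_sumr ler_wpM2l //.
elim: n n0 => // -[|n] IH _; first by rewrite big_nat1 ln1 addr0 invr1.
rewrite big_nat_recr //= (le_trans (lerD (IH _) (lexx _))) // -addrA lerD2l.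
have h0 : 0 < n.+1%:R / n.+2%:R :> R by rewrite divr_gt0.
have : ln (n.+1%:R / n.+2%:R : R) <= - n.+2%:R^-1.
  have -> : n.+1%:R / n.+2%:R = 1 + - n.+2%:R^-1 :> R.
    by rewrite -[n.+1%:R](addrK 1) natr1 mulrBl mulfV ?pnatr_eq0 // mul1r.
  by apply: le_ln1Dx; rewrite ltrN2 invf_lt1 // ltr1n.
by rewrite ln_div ?posrE // lerBlDr [- _ + _]addrC lerBrDr.
Qed.

Variable a : R.
Hypotheses (a0 : 0 < a) (a1 : a < 1).
Local Notation E := (toss_mean a).
Local Notation heads := (count id).
Local Notation w := (toss_dev a).

(** Each term of the Moebius expansion of the indicator is equidistributed up to
    the same error, so the total error is that error times the number of terms. *)
Lemma toss_mean_kfree_gcd h b i : (0 < i)%N ->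
  `|E h (fun s => kfree_gcd i (b + heads s)) - kfree_density i|
  <= (num_kth_divisors i)%:R / w h.
Proof.
move=> i0.
rewrite (eq_toss_mean _ (G := fun s => \sum_(1 <= d < i.+1 | (d ^ k %| i)%N)
   (moebius d)%:~R * (d ^ k %| b + heads s)%N%:R)); last first.
  by move=> s _; exact: kfree_gcdE.
rewrite toss_mean_sum -sumrB (le_trans (ler_norm_sum _ _ _)) //.
rewrite natr_sum mulr_suml big_mkcond [leLHS]big_nat_cond [leRHS]big_nat_cond.
apply: ler_sum => d /andP[/andP[d0 _] _].
case: (d ^ k %| i)%N; last by rewrite mul0r.
rewrite toss_meanZ -mulrBr normrM mul1r -[leRHS]mul1r.
rewrite ler_pM ?norm_intr_moebius_le1 //.
by apply: toss_mean_dvdn; rewrite // expn_gt0 d0.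
Qed.

(** The sequence [s] records the walk, [true] for a step east, so that the number
    of heads in [take i s] is the abscissa at time [i]. *)
Definition fluctuation i (s : seq bool) : R :=
  kfree_gcd i (heads (take i s)) - kfree_density i.

Definition total_fluctuation n s : R := \sum_(1 <= i < n.+1) fluctuation i s.

Lemma norm_fluctuation_le1 i s : (0 < i)%N -> `|fluctuation i s| <= 1.
Proof.
move=> /kfree_density_bounds /andP[g0 g1]; rewrite /fluctuation /kfree_gcd.
by case: `[< _ >]; rewrite ler_norml /=; lra.
Qed.

Lemma norm_sum_fluctuation_le m n s :
  `|\sum_(m.+1 <= i < n.+1) fluctuation i s| <= (n - m)%N%:R.
Proof.
rewrite (le_trans (ler_norm_sum _ _ _)) //.
rewrite (@le_trans _ _ (\sum_(m.+1 <= i < n.+1) 1)) //.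
  rewrite [leLHS]big_nat_cond [leRHS]big_nat_cond.
  apply: ler_sum => i /andP[/andP[mi _] _].
  by apply: norm_fluctuation_le1; apply: leq_trans mi.
by rewrite sumr_const_nat subSS.
Qed.

Lemma total_fluctuation_take m n s : (m <= n)%N ->
  total_fluctuation m (take n s) = total_fluctuation m s.
Proof.
move=> mn; rewrite /total_fluctuation [LHS]big_nat_cond [RHS]big_nat_cond.
apply: eq_bigr => i /andP[/andP[_ im] _].
by rewrite /fluctuation take_takel // (leq_trans _ mn).
Qed.

(** Decorrelation.  If [m <= h] the past is short and is bounded trivially;
    otherwise it is cut at time [p = m.+1 - h].  The fluctuations
    between [p] and [m.+1] number less than [h] and are bounded by [1]; given the tosses up to [p],
    the fluctuation at time [m.+1] has small conditional mean. *)
Lemma total_fluctuation_cross n h m : (0 < h)%N -> (m < n)%N ->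
  E m.+1 (fun s => total_fluctuation m s * fluctuation m.+1 s)
  <= h%:R + n%:R * ((num_kth_divisors m.+1)%:R / w h).
Proof.
move=> h0 mn; set tau := _%:R / w h.
have tau0 : 0 <= tau by rewrite divr_ge0 // ltW // toss_dev_gt0.
have [mh|hm] := leqP m h.
  apply: (@le_trans _ _ h%:R); last by rewrite lerDl mulr_ge0.
  rewrite -[leRHS](toss_mean_cst a m.+1) le_toss_mean // => s _.
  rewrite (le_trans (ler_norm _)) // normrM -[leRHS]mulr1.
  rewrite ler_pM ?norm_fluctuation_le1 //.
  by rewrite (le_trans (norm_sum_fluctuation_le 0 m s)) // subn0 ler_nat.
pose p := (m.+1 - h)%N; have pm : (p <= m)%N by rewrite /p; lia.
have pE : m.+1 = (p + h)%N by rewrite /p subnK //; exact: leqW (ltnW hm).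
have split_sum s : total_fluctuation m s =
    total_fluctuation p s + \sum_(p.+1 <= i < m.+1) fluctuation i s.
  by rewrite /total_fluctuation -big_cat_nat.
rewrite (eq_toss_mean _ (G := fun s =>
    (\sum_(p.+1 <= i < m.+1) fluctuation i s) * fluctuation m.+1 s +
    total_fluctuation p s * fluctuation m.+1 s)); last first.
  by move=> s _; rewrite split_sum mulrDl addrC.
rewrite toss_meanD lerD //.
  rewrite -[leRHS](toss_mean_cst a m.+1) le_toss_mean // => s _.
  rewrite (le_trans (ler_norm _)) // normrM -[leRHS]mulr1.
  rewrite ler_pM ?norm_fluctuation_le1 //.
  rewrite (le_trans (norm_sum_fluctuation_le _ _ _)) // ler_nat /p; lia.
rewrite {1}pE toss_mean_cat -[leRHS](toss_mean_cst a p) le_toss_mean // => s hs.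
rewrite (eq_toss_mean _ (G := fun t => total_fluctuation p s *
    (kfree_gcd m.+1 (heads s + heads t) + - kfree_density m.+1))); last first.
  move=> t ht; rewrite -(total_fluctuation_take (s ++ t) (leqnn p)).
  rewrite take_size_cat // /fluctuation take_oversize ?count_cat //.
  by rewrite size_cat hs ht pE.
rewrite toss_meanZ toss_meanD toss_mean_cst (le_trans (ler_norm _)) // normrM.
rewrite ler_pM // ?toss_mean_kfree_gcd //.
rewrite (le_trans (norm_sum_fluctuation_le 0 p s)) // subn0 ler_nat; lia.
Qed.

(** Expanding the square one step at a time leaves a bounded square and twice a
    cross term at each step. *)
Lemma second_moment_total_fluctuation n h : (0 < h)%N ->
  E n (fun s => total_fluctuation n s ^+ 2)
  <= \sum_(1 <= j < n.+1)
       (1 + 2 * (h%:R + n%:R * ((num_kth_divisors j)%:R / w h))).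
Proof.
move=> h0; suff H m : (m <= n)%N -> E m (fun s => total_fluctuation m s ^+ 2)
    <= \sum_(1 <= j < m.+1)
         (1 + 2 * (h%:R + n%:R * ((num_kth_divisors j)%:R / w h))).
  exact: H.
elim: m => [_|m IH mn].
  by rewrite /= /total_fluctuation !big_geq // expr0n.
rewrite [leRHS]big_nat_recr //.
rewrite (eq_toss_mean _ (G := fun s => total_fluctuation m (take m s) ^+ 2 +
   (fluctuation m.+1 s ^+ 2 +
    2 * (total_fluctuation m s * fluctuation m.+1 s)))); last first.
  move=> s _; rewrite total_fluctuation_take //.
  have -> : total_fluctuation m.+1 s =
      total_fluctuation m s + fluctuation m.+1 s.
    by rewrite /total_fluctuation big_nat_recr.
  by ring.
rewrite toss_meanD (toss_mean_take _ (fun s => total_fluctuation m s ^+ 2)) //.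
rewrite lerD ?IH 1?ltnW // toss_meanD lerD //.
  rewrite -[leRHS](toss_mean_cst a m.+1) le_toss_mean // => s _.
  by rewrite -real_normK ?num_real // expr_le1 // norm_fluctuation_le1.
by rewrite toss_meanZ ler_pM2l // total_fluctuation_cross.
Qed.

End KfreeFluctuation.

(** * Tannery's theorem and the reciprocal of zeta *)

Section Tannery.
Variable R : realType.
Implicit Types (b l : nat -> R) (u : nat -> nat -> R).

Lemma dominated_cvg_series b l :
  (forall i, `|l i| <= b i) -> cvgn (series b) -> cvgn (series l).
Proof.
move=> lb cb; apply: normed_cvg; apply: (series_le_cvg _ _ lb cb) => i //.
exact: le_trans (normr_ge0 _) (lb i).
Qed.

Lemma dist_lim_series_le b l (D : nat) :
  (forall i, `|l i| <= b i) -> cvgn (series b) ->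
  `|limn (series l) - series l D| <= limn (series b) - series b D.
Proof.
move=> lb cb; have cl := dominated_cvg_series lb cb.
have cN : `|series l n - series l D| @[n --> \oo] -->
    `|limn (series l) - series l D|.
  by apply: cvg_norm; apply: cvgB => //; exact: cvg_cst.
have cB : series b n - series b D @[n --> \oo] --> limn (series b) - series b D.
  by apply: cvgB => //; exact: cvg_cst.
rewrite -(cvg_lim _ cN) // -(cvg_lim _ cB) //.
apply: ler_lim; [by apply: cvgP cN|by apply: cvgP cB|].
near=> n; have Dn : (D <= n)%N by near: n; exact: nbhs_infty_ge.
rewrite !sub_series_geq // (le_trans (ler_norm_sum _ _ _)) //.
by apply: ler_sum.
Unshelve. all: by end_near. Qed.

(** Tannery's theorem, dominated convergence for series. *)
Lemma tannery b l u : cvgn (series b) -> (forall n i, `|u n i| <= b i) ->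
  (forall i, u n i @[n --> \oo] --> l i) ->
  \sum_(0 <= i < n) u n i @[n --> \oo] --> limn (series l).
Proof.
move=> cb ub ul.
have lb i : `|l i| <= b i.
  have h : `|u n i| @[n --> \oo] --> `|l i| by apply: cvg_norm; exact: ul.
  rewrite -(cvg_lim _ h) //; apply: limr_le; first by apply: cvgP h.
  by near=> n; exact: ub.
have b0 i : 0 <= b i by exact: le_trans (normr_ge0 _) (lb i).
apply/cvgrPdist_le => e e0; have e3 : 0 < e / 3 by rewrite divr_gt0.
have [D _ hD] : \forall D \near \oo, `|limn (series b) - series b D| <= e / 3.
  exact: (cvgrPdist_le _ _).1 cb _ e3.
have {}hD : limn (series b) - series b D <= e / 3.
  by rewrite (le_trans (ler_norm _)) // hD /=.
have cD : \sum_(0 <= i < D) u n i @[n --> \oo] --> series l D.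
  elim: (D) => [|m IH].
    rewrite (_ : (fun n => _) = fun=> 0); last first.
      by apply/funext => n; rewrite big_geq.
    by rewrite /series /= big_geq //; exact: cvg_cst.
  rewrite (_ : (fun n => _) = fun n => \sum_(0 <= i < m) u n i + u n m).
    by rewrite /series /= big_nat_recr //=; apply: cvgD.
  by apply/funext => n; rewrite big_nat_recr.
have cDe : \forall n \near \oo,
    `|series l D - \sum_(0 <= i < D) u n i| <= e / 3.
  exact: (cvgrPdist_le _ _).1 cD _ e3.
near=> n; have Dn : (D <= n)%N by near: n; exact: nbhs_infty_ge.
rewrite (big_cat_nat (leq0n D) Dn) /=.
have h1 := le_trans (dist_lim_series_le D lb cb) hD.
have h2 : `|series l D - \sum_(0 <= i < D) u n i| <= e / 3 by near: n.
have h3 : `|\sum_(D <= i < n) u n i| <= e / 3.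
  rewrite (le_trans (ler_norm_sum _ _ _)) // (le_trans _ hD) //.
  apply: (@le_trans _ _ (series b n - series b D)).
    by rewrite sub_series_geq //; apply: ler_sum.
  rewrite lerD2r nondecreasing_cvgn_le //.
  by apply: nondecreasing_series => i _ _.
rewrite (_ : _ - _ = (limn (series l) - series l D) +
   (series l D - \sum_(0 <= i < D) u n i) - \sum_(D <= i < n) u n i);
  last by ring.
rewrite (le_trans (ler_normB _ _)) //.
have := ler_normD (limn (series l) - series l D)
  (series l D - \sum_(0 <= i < D) u n i).
lra.
Unshelve. all: by end_near. Qed.

End Tannery.

Section ZetaReciprocal.
Variables (R : realType) (s : nat).
Hypothesis s2 : (2 <= s)%N.

Definition dirichlet_term (i : nat) : R := (i.+1%:R ^+ s)^-1.
Local Notation z := dirichlet_term.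

Lemma dirichlet_term_ge0 i : 0 <= z i.
Proof. by rewrite invr_ge0 exprn_ge0. Qed.

Lemma series_dirichlet_le n : series z n.+1 <= 2 - n.+1%:R^-1.
Proof.
elim: n => [|n IH].
  rewrite /series /= big_nat1 /z expr1n invr1; lra.
rewrite /series /= big_nat_recr //= (le_trans (lerD IH (lexx _))) //.
have h : z n.+1 <= n.+1%:R^-1 - n.+2%:R^-1.
  have -> : n.+1%:R^-1 - n.+2%:R^-1 = (n.+1%:R * n.+2%:R : R)^-1.
    have n1 : n.+1%:R != 0 :> R by rewrite pnatr_eq0.
    have n2 : n.+2%:R != 0 :> R by rewrite pnatr_eq0.
    apply: (mulfI (mulf_neq0 n1 n2)).
    rewrite mulfV ?mulf_neq0 // mulrBr [X in X - _]mulrAC mulfV // mul1r.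
    rewrite mulfK //.
    by rewrite -natr1 addrC addKr.
  rewrite lef_pV2 ?posrE ?exprn_gt0 ?mulr_gt0 //.
  apply: (@le_trans _ _ (n.+2%:R ^+ 2)).
    by rewrite expr2 ler_wpM2r // ler_nat.
  by rewrite ler_weXn2l // ler1n.
by rewrite -addrA lerD2l addrC -lerBrDr opprK [leRHS]addrC.
Qed.

Lemma is_cvg_series_dirichlet : cvgn (series z).
Proof.
apply: nondecreasing_is_cvgn.
  by apply: nondecreasing_series => i _ _; exact: dirichlet_term_ge0.
exists 2 => _ [n _ <-]; case: n => [|n]; first by rewrite /series /= big_geq.
by rewrite (le_trans (series_dirichlet_le n)) // gerBl.
Qed.

Lemma zetaE : zeta s%:R = limn (series z) :> R.
Proof.
by rewrite /zeta; congr (limn (series _)); apply/funext => n;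
   rewrite powRN powR_mulrn.
Qed.

Definition moebius_dirichlet_term (i : nat) : R := (moebius i.+1)%:~R * z i.
Local Notation c := moebius_dirichlet_term.

Lemma norm_moebius_dirichlet_term_le i : `|c i| <= z i.
Proof.
rewrite normrM (ger0_norm (dirichlet_term_ge0 i)) ler_piMl //.
  exact: dirichlet_term_ge0.
exact: norm_intr_moebius_le1.
Qed.

(** The double sum runs over the pairs [(d, e)] with [d * e <= n]; grouped by the
    product [m = d * e] it becomes the sum of [m ^ - s] times the sum of [moebius]
    over the divisors of [m], of which only [m = 1] survives. *)
Lemma sum_moebius_dirichlet_partial n : (0 < n)%N ->
  \sum_(0 <= i < n) c i * series z (n %/ i.+1)%N = 1.
Proof.
move=> n0.
pose f m : R := (m%:R ^+ s)^-1.
transitivity (\sum_(1 <= d < n.+1) \sum_(1 <= m < n.+1 | (d %| m)%N)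
    (moebius d)%:~R * f m).
  rewrite [RHS]big_add1 /=; apply: eq_bigr => i _.
  rewrite -mulr_sumr sum_multiples // /c -mulrA; congr (_ * _).
  rewrite [RHS]big_add1 /= /series /= mulr_sumr; apply: eq_bigr => j _.
  by rewrite /f /z natrM exprMn invfM.
rewrite (exchange_big_dep predT) //=.
under eq_bigr do rewrite -mulr_suml.
have sumE m : (0 < m <= n)%N ->
    \sum_(1 <= d < n.+1 | (d %| m)%N) (moebius d)%:~R = (m == 1)%N%:R :> R.
  move=> /sum_moebius /(congr1 (intmul 1 : int -> R)).
  by rewrite rmorph_sum rmorph_nat.
rewrite big_ltn // sumE // /f expr1n invr1 mulr1 -[RHS]addr0; congr (_ + _).
rewrite big_nat_cond big1 // => m /andP[mn _]; have /andP[m1 mn1] := mn.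
by rewrite sumE ?(gtn_eqF m1) ?mul0r // (ltnW m1).
Qed.

(** Tannery's theorem applied to the identity above: each truncated zeta sum
    [series z (n %/ d)] tends to the zeta value, so the limit of the left-hand
    side is the product of the two series. *)
Lemma lim_series_moebius : limn (series c) = 1 / zeta s%:R.
Proof.
pose Z : R := limn (series z).
have zZ n : series z n <= Z.
  apply: nondecreasing_cvgn_le is_cvg_series_dirichlet n.
  by apply: nondecreasing_series => i _ _; exact: dirichlet_term_ge0.
have z0 n : 0 <= series z n.
  by apply: sumr_ge0 => i _; exact: dirichlet_term_ge0.
have Z0 : 0 < Z.
  apply: lt_le_trans (zZ 1%N); rewrite /series /= big_nat1 /z expr1n invr1.
  exact: ltr01.
have : \sum_(0 <= i < n) c i * series z (n %/ i.+1)%N @[n --> \oo] -->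
    limn (series (fun i => Z * c i)).
  apply: (@tannery _ (fun i => Z * z i)) => [|n i|i].
  - by apply: is_cvg_seriesZ; exact: is_cvg_series_dirichlet.
  - rewrite normrM mulrC ler_pM ?norm_moebius_dirichlet_term_le //.
    by rewrite ger0_norm.
  - rewrite mulrC; apply: cvgM; first exact: cvg_cst.
    apply: (@cvg_comp _ _ _ (fun n => (n %/ i.+1)%N) (series z)).
      exact: cvg_divnr.
    exact: is_cvg_series_dirichlet.
have cc : cvgn (series c).
  exact: dominated_cvg_series norm_moebius_dirichlet_term_le
    is_cvg_series_dirichlet.
rewrite (lim_seriesZ Z cc) => h.
have : \sum_(0 <= i < n) c i * series z (n %/ i.+1)%N @[n --> \oo] --> (1 : R).
  apply: cvg_near_cst; near=> n; apply: sum_moebius_dirichlet_partial.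
  by near: n; exact: nbhs_infty_gt.
move=> /(cvg_unique _ h) e; have {}e := e (@norm_hausdorff _ _).
by rewrite zetaE -/Z -e [Z *: _]mulrC mulfK ?gt_eqF.
Unshelve. all: by end_near. Qed.

End ZetaReciprocal.

Section MeanDensity.
Variables (R : realType) (k : nat).
Hypothesis k0 : (0 < k)%N.

Lemma cvg_divn_quotient q : (0 < q)%N ->
  (n %/ q)%N%:R / n%:R @[n --> \oo] --> (q%:R^-1 : R).
Proof.
move=> q0; have qR : 0 < q%:R :> R by rewrite ltr0n.
apply: (@squeeze_cvgr _ _ _ _ (fun n : nat => q%:R^-1 - n%:R^-1)
  (fun=> q%:R^-1)); last exact: cvg_cst.
  near=> n; have n0 : 0 < n%:R :> R.
    by rewrite ltr0n; near: n; exact: nbhs_infty_gt.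
  apply/andP; split.
    rewrite ler_pdivlMr // mulrBl mulVf ?gt_eqF // lerBlDr natr1.
    by rewrite ler_pdivrMl // -natrM ler_nat mulnC ltnW // ltn_ceil.
  rewrite ler_pdivrMr // ler_pdivlMl // -natrM ler_nat mulnC.
  exact: leq_trunc_div.
rewrite -[X in _ --> X]subr0; apply: cvgB; first exact: cvg_cst.
have := @cvg_harmonic R; rewrite -(cvg_shiftS (fun n : nat => n%:R^-1 : R)).
exact.
Unshelve. all: by end_near. Qed.

Lemma sum_kfree_density n :
  \sum_(1 <= i < n.+1) kfree_density R k i =
  \sum_(0 <= d < n)
    (moebius d.+1)%:~R / (d.+1 ^ k)%N%:R * (n %/ d.+1 ^ k)%N%:R.
Proof.
transitivity (\sum_(1 <= d < n.+1) \sum_(1 <= i < n.+1 | (d ^ k %| i)%N)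
    ((moebius d)%:~R / (d ^ k)%N%:R : R)).
  rewrite [RHS](exchange_big_dep predT) //=.
  rewrite [LHS]big_nat_cond [RHS]big_nat_cond.
  apply: eq_bigr => i /andP[/andP[i0 ilt] _].
  rewrite [RHS](@big_cat_nat _ _ _ i.+1) //= -[LHS]addr0; congr (_ + _).
  rewrite big_nat_cond big1 // => d /andP[/andP[id _] dki]; exfalso.
  have := dvdn_leq i0 dki; rewrite leqNgt => /negP; apply.
  by rewrite (leq_trans id) // -{1}(expn1 d) leq_pexp2l // (leq_trans _ id).
rewrite big_add1 /=; apply: eq_bigr => d _.
rewrite divn_count_dvd natr_sum mulr_sumr big_mkcond /=.
by apply: eq_bigr => i _; case: (_ %| i)%N; rewrite ?mulr1 ?mulr0.
Qed.

(** Exchanging sums, the mean is the sum over [d] of [moebius d / d ^ k] times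
    [(n %/ d ^ k) / n], whose terms tend to [moebius d / d ^ (2 * k)] and are
    dominated by [1 / d ^ (2 * k)]. *)
Lemma cvg_mean_kfree_density :
  (\sum_(1 <= i < n.+1) kfree_density R k i) / n%:R @[n --> \oo]
    --> 1 / zeta (2 * k)%N%:R.
Proof.
have s2 : (2 <= 2 * k)%N by exact: leq_pmulr.
rewrite -lim_series_moebius //.
pose u n d : R :=
  (moebius d.+1)%:~R / (d.+1 ^ k)%N%:R * ((n %/ d.+1 ^ k)%N%:R / n%:R).
rewrite (_ : (fun n : nat => _) = fun n => \sum_(0 <= d < n) u n d); last first.
  apply/funext => n; rewrite sum_kfree_density mulr_suml.
  by apply: eq_bigr => d _; rewrite /u mulrA.
have zE d : dirichlet_term R (2 * k) d =
    (d.+1 ^ k)%N%:R^-1 * (d.+1 ^ k)%N%:R^-1.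
  by rewrite /dirichlet_term mulnC exprM expr2 -natrX invfM.
apply: (@tannery _ (dirichlet_term R (2 * k))) => [|n d|d].
- exact: is_cvg_series_dirichlet.
- have qR : 0 < (d.+1 ^ k)%N%:R :> R by rewrite ltr0n expn_gt0.
  rewrite /u normrM normrM zE [X in _ * X * _]gtr0_norm ?invr_gt0 //.
  rewrite ler_pM ?mulr_ge0 ?invr_ge0 ?(ltW qR) //.
    by rewrite ler_piMl ?invr_ge0 ?(ltW qR) // norm_intr_moebius_le1.
  rewrite ger0_norm ?divr_ge0 //; have [->|n0] := posnP n.
    by rewrite invr0 mulr0 invr_ge0 ltW.
  rewrite ler_pdivrMr ?ltr0n // ler_pdivlMl // -natrM ler_nat mulnC.
  exact: leq_trunc_div.
- rewrite /moebius_dirichlet_term zE mulrA; apply: cvgM; first exact: cvg_cst.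
  by apply: cvg_divn_quotient; rewrite expn_gt0.
Qed.

End MeanDensity.

(** * Averages along sparse times *)

Section SparseMeans.
Variable R : realType.
Implicit Type y : nat -> R.

Lemma cvg_ratio_exp p : (m.+2%:R / m.+1%:R) ^+ p @[m --> \oo] --> (1 : R).
Proof.
have c1 : m.+2%:R / m.+1%:R @[m --> \oo] --> (1 : R).
  have -> : (fun m => m.+2%:R / m.+1%:R : R) = fun m => 1 + harmonic m.
    apply/funext => m; rewrite /harmonic -[m.+2%:R]natr1 mulrDl mul1r.
    by rewrite mulfV ?pnatr_eq0.
  suff: 1 + harmonic m @[m --> \oo] --> (1 + 0 : R) by rewrite addr0.
  by apply: cvgD; [exact: cvg_cst|exact: cvg_harmonic].
elim: p => [|p IH].
  by under eq_fun do rewrite expr0; exact: cvg_cst.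
under eq_fun do rewrite exprS.
have := cvgM c1 IH; rewrite mulr1; exact.
Qed.

Lemma exists_power_bracket p n : (0 < p)%N -> (0 < n)%N ->
  exists m, (m.+1 ^ p <= n < m.+2 ^ p)%N.
Proof.
move=> p0 n0.
have ex : exists m, (m.+1 ^ p <= n)%N by exists 0%N; rewrite exp1n.
have bd m : (m.+1 ^ p <= n)%N -> (m <= n)%N.
  move=> h; rewrite (leq_trans _ h) // (leq_trans (leqnSn m)) //.
  by rewrite -{1}(expn1 m.+1) leq_pexp2l.
case: (ex_maxnP ex bd) => m mn mM; exists m; rewrite mn ltnNge.
by apply/negP => /mM; rewrite ltnn.
Qed.

(** Means of a bounded sequence move little between two consecutive [p]-th
    powers, because the ratio of these powers tends to [1]. *)
Lemma sparse_means_cvg0 p y : (0 < p)%N ->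
  (forall i, (0 < i)%N -> `|y i| <= 1) ->
  (\sum_(1 <= i < (m.+1 ^ p).+1) y i) / (m.+1 ^ p)%N%:R @[m --> \oo]
    --> (0 : R) ->
  (\sum_(1 <= i < n.+1) y i) / n%:R @[n --> \oo] --> (0 : R).
Proof.
move=> p0 y1 h.
pose A m : R := `|(\sum_(1 <= i < (m.+1 ^ p).+1) y i) / (m.+1 ^ p)%N%:R|.
pose B m : R := A m + ((m.+2%:R / m.+1%:R) ^+ p - 1).
have B0 : B m @[m --> \oo] --> (0 : R).
  have := cvgD (cvg_norm h) (cvgB (cvg_ratio_exp p) (cvg_cst (1 : R))).
  by rewrite normr0 subrr addr0; exact.
have key m n : (m.+1 ^ p <= n < m.+2 ^ p)%N ->
    `|(\sum_(1 <= i < n.+1) y i) / n%:R| <= B m.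
  move=> /andP[mn nm].
  have q0 : 0 < (m.+1 ^ p)%N%:R :> R by rewrite ltr0n expn_gt0.
  have n0 : 0 < n%:R :> R by rewrite (lt_le_trans q0) // ler_nat.
  have qn : (m.+1 ^ p)%N%:R <= n%:R :> R by rewrite ler_nat.
  rewrite normrM [X in _ * X]gtr0_norm ?invr_gt0 // ler_pdivrMr //.
  rewrite (@big_cat_nat _ _ _ (m.+1 ^ p).+1) //= (le_trans (ler_normD _ _)) //.
  rewrite /B mulrDl lerD //.
    rewrite /A normrM [X in _ * X * _]gtr0_norm ?invr_gt0 // -mulrA.
    by rewrite ler_peMr // ler_pdivlMl // mulr1.
  rewrite (le_trans (ler_norm_sum _ _ _)) //.
  apply: (@le_trans _ _ (\sum_((m.+1 ^ p).+1 <= i < n.+1) 1)).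
    rewrite [leLHS]big_nat_cond [leRHS]big_nat_cond.
    apply: ler_sum => i /andP[/andP[mi _] _]; apply: y1.
    exact: leq_ltn_trans mi.
  rewrite sumr_const_nat subSS expr_div_n -!natrX natrB //.
  have r1 : 0 <= (m.+2 ^ p)%N%:R / (m.+1 ^ p)%N%:R - 1 :> R.
    by rewrite subr_ge0 ler_pdivlMr // mul1r ler_nat leq_exp2r.
  apply: (@le_trans _ _
    (((m.+2 ^ p)%N%:R / (m.+1 ^ p)%N%:R - 1) * (m.+1 ^ p)%N%:R)).
    rewrite mulrBl divfK ?gt_eqF // mul1r lerD2r ler_nat; exact: ltnW.
  by rewrite ler_wpM2l.
apply/cvgrPdist_le => e e0.
have [M _ hM] : \forall m \near \oo, `|0 - B m| <= e.
  exact: (cvgrPdist_le _ _).1 B0 _ e0.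
near=> n; rewrite sub0r normrN.
have n0 : (0 < n)%N by near: n; exact: nbhs_infty_gt.
have Mn : (M.+1 ^ p <= n)%N by near: n; exact: nbhs_infty_ge.
have [m mn] := exists_power_bracket p0 n0.
rewrite (le_trans (key _ _ mn)) // (le_trans (ler_norm _)) // -normrN -sub0r.
apply: hM => /=; rewrite leqNgt; apply/negP => mM.
have /andP[_] := mn; rewrite ltnNge => /negP; apply.
by rewrite (leq_trans _ Mn) // leq_exp2r.
Unshelve. all: by end_near. Qed.

End SparseMeans.

Section SparseSecondMoment.
Variables (R : realType) (k : nat) (a : R).
Hypotheses (k0 : (0 < k)%N) (a0 : 0 < a) (a1 : a < 1).

(** With [n = M ^ 8] tosses and decorrelation time [h = M ^ 6], the two error
    terms [h / n] and [ln n / sqrt h] are both of order at most [M ^ -2], which is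
    summable over [M]. *)
Lemma second_moment_eighth_power :
  exists C : R, forall m,
    toss_mean a (m.+1 ^ 8) (fun s =>
      (total_fluctuation R k (m.+1 ^ 8) s / (m.+1 ^ 8)%N%:R) ^+ 2)
    <= C * dirichlet_term R 2 m.
Proof.
pose c : R := Num.sqrt (a * (1 - a)).
have b0 : 0 < 1 - a by rewrite subr_gt0.
have c0 : 0 < c by rewrite sqrtr_gt0 mulr_gt0.
exists (3 + 18 / c) => m.
pose M : R := m.+1%:R; have M1 : 1 <= M by rewrite /M ler1n.
have M0 : 0 < M by exact: lt_le_trans M1.
set n := (m.+1 ^ 8)%N; have nM : n%:R = M ^+ 8 :> R by rewrite natrX.
have n0 : (0 < n)%N by rewrite expn_gt0.
pose h := (m.+1 ^ 6)%N; have hM : h%:R = M ^+ 6 :> R by rewrite natrX.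
have h0 : (0 < h)%N by rewrite expn_gt0.
have wh : c * M ^+ 3 <= toss_dev a h.
  have -> : M ^+ 3 = Num.sqrt h%:R.
    rewrite hM (_ : M ^+ 6 = (M ^+ 3) ^+ 2) -?exprM //.
    by rewrite exprM sqrtr_sqr ger0_norm ?exprn_ge0 ?(ltW M0).
  rewrite -sqrtrM ?mulr_ge0 ?(ltW a0) ?(ltW b0) // mulrC.
  by rewrite ler_wsqrtr // ler_wpM2r ?mulr_ge0 ?(ltW a0) ?(ltW b0) // ler_nat.
rewrite (eq_toss_mean _ (G := fun s =>
    (n%:R ^- 2) * total_fluctuation R k n s ^+ 2)); last first.
  by move=> s _; rewrite expr_div_n mulrC.
rewrite toss_meanZ ler_pdivrMl ?exprn_gt0 ?ltr0n //.
rewrite (le_trans (second_moment_total_fluctuation k0 a0 a1 n h0)) //.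
have cst (x : R) : \sum_(1 <= j < n.+1) x = n%:R * x.
  by rewrite sumr_const_nat subSS subn0 mulr_natl.
rewrite big_split /= cst mulr1 -mulr_sumr big_split /= cst.
rewrite -mulr_sumr -mulr_suml -natr_sum.
have lnn : ln n%:R <= 8 * M.
  rewrite nM lnXn // -[X in X <= _]mulr_natl ler_pM2l //.
  exact: ltW (ln_sublinear M0).
have T : (\sum_(1 <= j < n.+1) num_kth_divisors k j)%N%:R / toss_dev a h
    <= n%:R * (9 * M) / (c * M ^+ 3).
  rewrite ler_pM ?invr_ge0 ?(ltW (toss_dev_gt0 _ _ _)) //.
    rewrite (le_trans (sum_num_kth_divisors R k0 n0)) // ler_wpM2l //; lra.
  by rewrite lef_pV2 // posrE ?toss_dev_gt0 // mulr_gt0 // exprn_gt0.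
apply: (@le_trans _ _
  (n%:R + 2 * (n%:R * h%:R + n%:R * (n%:R * (9 * M) / (c * M ^+ 3))))).
  by rewrite lerD2l ler_pM2l // lerD2l ler_wpM2l.
rewrite /dirichlet_term -/M nM hM.
move: M M1 M0 {nM hM wh lnn T} => M M1 M0; have Mn0 : M != 0 by rewrite gt_eqF.
have cn0 : c != 0 by rewrite gt_eqF.
have -> : (M ^+ 8) ^+ 2 * ((3 + 18 / c) * (M ^+ 2)^-1) =
    3 * M ^+ 14 + 18 / c * M ^+ 14 by field; rewrite cn0 Mn0.
have -> : M ^+ 8 + 2 * (M ^+ 8 * M ^+ 6 +
    M ^+ 8 * (M ^+ 8 * (9 * M) / (c * M ^+ 3))) =
    M ^+ 8 + 2 * M ^+ 14 + 18 / c * M ^+ 14 by field; rewrite cn0 Mn0.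
rewrite lerD2r; have : M ^+ 8 <= M ^+ 14 by rewrite ler_weXn2l.
lra.
Qed.

End SparseSecondMoment.

(** * From independent steps to coin tosses *)

Lemma measurable_lattice_point (v : int * int) : measurable [set v].
Proof.
case: v => x y; rewrite (_ : [set _] = [set x] `*` [set y]).
  exact: measurableX.
by apply/seteqP; split => [[u v] [-> ->]//|[u v] [/= -> ->]].
Qed.

Section CoinTosses.
Context (d : measure_display) (T : measurableType d) (R : realType).
Variables (P : probability T R) (a : R).
Variable xi : nat -> {RV P >-> (int * int)%type}.
Hypothesis steps : alpha_steps P a xi.

Definition east_steps n (t : T) : seq bool :=
  mkseq (fun i => xi i t == (1, 0)) n.

Lemma measurable_east i : measurable (xi i @^-1` [set (1, 0)]).
Proof. by apply: measurable_funPTI; exact: measurable_lattice_point. Qed.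

Lemma measurable_east_steps n (Q : set (seq bool)) :
  measurable (east_steps n @^-1` Q).
Proof.
elim: n Q => [|n IH] Q.
  have [Q0|Q0] := pselect (Q [::]).
    by rewrite (_ : _ @^-1` _ = setT) //; apply/seteqP; split => t.
  by rewrite (_ : _ @^-1` _ = set0) //; apply/seteqP; split => t.
pose H := xi n @^-1` [set (1, 0)].
rewrite (_ : _ @^-1` Q =
    (H `&` (east_steps n @^-1` [set s | Q (rcons s true)])) `|`
    (~` H `&` (east_steps n @^-1` [set s | Q (rcons s false)]))).
  have mH : measurable H := measurable_east n.
  by apply: measurableU; apply: measurableI => //; apply: measurableC.
apply/seteqP; split => t; rewrite /preimage /= /east_steps mkseqS.
  case: eqP => h; [by left|by right].
by case=> -[h]; [rewrite h eqxx|case: eqP].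
Qed.

Lemma measurable_fun_east_steps n (F : seq bool -> R) :
  measurable_fun setT (fun t => (F (east_steps n t))%:E).
Proof.
move=> _ Y mY; rewrite setTI.
exact: (measurable_east_steps n [set s | Y (F s)%:E]).
Qed.

Lemma probability_east i : P (xi i @^-1` [set (1, 0)]) = a%:E.
Proof. by have [_ /(_ i)[<- _]] := steps. Qed.

Definition prefix_event (s : seq bool) : set T :=
  east_steps (size s) @^-1` [set s].

Lemma measurable_prefix_event s : measurable (prefix_event s).
Proof. exact: measurable_east_steps. Qed.

(** The cylinder is a finite intersection of events on distinct steps, east steps
    where [s] is true and complements of east steps elsewhere, so independence
    gives the product. *)
Lemma probability_prefix_event s :
  P (prefix_event s) = (\prod_(b <- s) (if b then a else 1 - a))%:E.
Proof.
(* A failed toss is encoded by any step other than the east one, so that the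
   law of the tosses involves only the probability of an east step. *)
pose A i : set (int * int) :=
  if nth false s i then [set (1, 0)] else ~` [set (1, 0)].
have mA i : measurable (A i).
  by rewrite /A; case: ifP => _; [|apply: measurableC];
     exact: measurable_lattice_point.
pose J := [fset i in iota 0 (size s)]%fset.
have JE : perm_eq J (iota 0 (size s)).
  by apply: uniq_perm => [||i]; rewrite ?fset_uniq ?iota_uniq // inE.
rewrite (_ : prefix_event s = \bigcap_(i in [set` J]) (xi i @^-1` A i));
  last first.
  apply/seteqP; split => t.
    rewrite /prefix_event /= => ts i /=.
    rewrite !inE /= mem_iota /= add0n => si.
    rewrite /A -{1}ts nth_mkseq //; case: eqP => //.
  move=> h; rewrite /prefix_event /=; apply: (@eq_from_nth _ false).
    by rewrite size_mkseq.
  rewrite size_mkseq => i si; rewrite nth_mkseq //.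
  have : (xi i @^-1` A i) t by apply: h; rewrite /= !inE mem_iota.
  by rewrite /A /preimage /=; case: nth => /= [->|]; [rewrite eqxx|case: eqP].
have [indep _] := steps; rewrite (indep J A mA) (perm_big _ JE) /=.
rewrite (eq_bigr (fun i => (if nth false s i then a else 1 - a)%:E));
  last first.
  move=> i _; rewrite /A; case: nth; first exact: probability_east.
  rewrite -preimage_setC probability_setC ?probability_east //.
  exact: measurable_east.
rewrite prodEFin; congr (_%:E).
by rewrite -[in RHS](mkseq_nth false s) big_map.
Qed.

Lemma probability_prefix_rcons s b : P (prefix_event (rcons s b)) =
  ((if b then a else 1 - a)%:E * P (prefix_event s))%E.
Proof. by rewrite !probability_prefix_event big_rcons -EFinM mulrC. Qed.

Lemma prefix_event_split s :
  prefix_event s = prefix_event (rcons s true) `|` prefix_event (rcons s false).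
Proof.
apply/seteqP; split => t;
  rewrite /prefix_event /= !size_rcons /east_steps !mkseqS.
  by move=> ->; case: (_ == _); [left|right].
by case=> /rcons_inj[].
Qed.

(** Restricting to the cylinder of [s] makes the induction work: one more toss
    splits the cylinder in two, which matches the recursion of [toss_mean]. *)
Lemma integral_prefix_event n s (F : seq bool -> R) : (forall u, 0 <= F u) ->
  (\int[P]_(t in prefix_event s) (F (east_steps (size s + n) t))%:E)%E
  = ((toss_mean a n (fun u => F (s ++ u)))%:E * P (prefix_event s))%E.
Proof.
move=> F0; elim: n s => [|n IH] s.
  rewrite (eq_integral (cst (F s)%:E)) => [|t].
    by rewrite integral_cst /= ?cats0 //; exact: measurable_prefix_event.
  by rewrite inE addn0 => ->.
rewrite prefix_event_split ge0_integral_setU; first last.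
- rewrite disj_set2E; apply/eqP/seteqP; split => // t [].
  by rewrite /prefix_event /= !size_rcons => -> /rcons_inj[].
- by move=> t _; rewrite lee_fin.
- apply: (@measurable_funS _ _ _ _ setT) => //.
  exact: measurable_fun_east_steps.
- exact: measurable_prefix_event.
- exact: measurable_prefix_event.
have sz b : (size s + n.+1 = size (rcons s b) + n)%N.
  by rewrite size_rcons addnS.
rewrite {1}(sz true) {1}(sz false) !IH -prefix_event_split.
rewrite !probability_prefix_rcons.
rewrite probability_prefix_event -!EFinM -EFinD toss_meanS; congr (_%:E).
rewrite (eq_toss_mean a (G := fun u => F (s ++ true :: u))); last first.
  by move=> u _; rewrite cat_rcons.
rewrite (eq_toss_mean a (F := fun u => F (rcons s false ++ u))
  (G := fun u => F (s ++ false :: u))); last first.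
  by move=> u _; rewrite cat_rcons.
by ring.
Qed.

Lemma integral_east_steps n (F : seq bool -> R) : (forall u, 0 <= F u) ->
  (\int[P]_t (F (east_steps n t))%:E)%E = (toss_mean a n F)%:E.
Proof.
move=> F0; have := @integral_prefix_event n [::] F F0.
rewrite (_ : prefix_event [::] = setT); last by apply/seteqP; split.
by rewrite /= add0n probability_setT mule1.
Qed.

(** The sum over [m] of the nonnegative variables has finite mean, so it is finite
    almost everywhere, and the terms of a convergent series tend to [0]. *)
Lemma ae_cvg0_of_toss_mean (N : nat -> nat) (F : nat -> seq bool -> R)
    (b : nat -> R) :
  (forall m u, 0 <= F m u) ->
  (forall m, toss_mean a (N m) (F m) <= b m) -> cvgn (series b) ->
  {ae P, forall t, F m (east_steps (N m) t) @[m --> \oo] --> (0 : R)}.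
Proof.
move=> F0 Fb cb.
pose f m t := (F m (east_steps (N m) t))%:E.
have f0 m t : (0 <= f m t)%E by rewrite lee_fin.
have mf m : measurable_fun setT (f m) by exact: measurable_fun_east_steps.
pose S t := (\sum_(0 <= m <oo) f m t)%E.
have mS : measurable_fun setT S.
  by apply: ge0_emeasurable_sum.
have S0 t : (0 <= S t)%E by apply: nneseries_ge0.
have intS : (\int[P]_t S t < +oo)%E.
  rewrite integral_nneseries //.
  apply: (@le_lt_trans _ _ (limn (series b))%:E); last by rewrite ltry.
  apply: lime_le.
    by apply: is_cvg_nneseries => n _ _; apply: integral_ge0.
  have E0 m : 0 <= toss_mean a (N m) (F m).
    have := @integral_ge0 _ _ _ P setT (f m) (fun t _ => f0 m t).
    by rewrite integral_east_steps // lee_fin.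
  near=> n; under eq_bigr do rewrite integral_east_steps //.
  rewrite sumEFin lee_fin (@le_trans _ _ (series b n)) //.
    by apply: ler_sum.
  apply: nondecreasing_cvgn_le => //; apply: nondecreasing_series => m _ _.
  exact: le_trans (E0 m) (Fb m).
have /(integrable_ae measurableT) : P.-integrable setT S.
  apply/integrableP; split=> //.
  by under eq_integral do rewrite gee0_abs //.
apply: filterS => t /(_ I) St.
apply: cvg_series_cvg_0; apply: nnseries_is_cvg => [m|]; first exact: F0.
by move: St; rewrite ge0_fin_numE.
Unshelve. all: by end_near. Qed.

(** The two prescribed probabilities add up to [1]. *)
Lemma ae_unit_step : {ae P, forall t i, xi i t = (1, 0) \/ xi i t = (0, 1)}.
Proof.
apply: ae_foralln => i.
have mN : measurable (xi i @^-1` [set (0, 1)]).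
  by apply: measurable_funPTI; exact: measurable_lattice_point.
have mU := measurableU _ _ (measurable_east i) mN.
exists (~` (xi i @^-1` [set (1, 0)] `|` xi i @^-1` [set (0, 1)])); split.
- exact: measurableC.
- apply: (etrans (probability_setC P mU)); rewrite measureU //.
    have [_ /(_ i)[h1 h2]] := steps.
    rewrite [X in (_ - (X + _))%E]h1 [X in (_ - (_ + X))%E]h2.
    by rewrite -EFinD [a + _]addrC subrK subrr.
  exact: measurable_east.
  by apply/seteqP; split => t // [] /= ->.
- by move=> t /= h [h1|h1]; apply: h; [left|right].
Qed.

Lemma walkE t n : (forall i, xi i t = (1, 0) \/ xi i t = (0, 1)) ->
  walk (fun i => xi i) n t =
  ((count id (east_steps n t))%:Z, (count negb (east_steps n t))%:Z).
Proof.
move=> h; elim: n => [|n IH]; first by [].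
rewrite [LHS]/= IH /east_steps mkseqS -cats1 !count_cat /=.
by case: (h n) => ->; rewrite /= !addn0 ?addn1; congr (_, _);
   rewrite /= ?addr0 // addrC.
Qed.

Lemma visit_indicatorE k t n : (forall i, xi i t = (1, 0) \/ xi i t = (0, 1)) ->
  (0 < n)%N ->
  visit_indicator R k (walk (fun i => xi i)) n t =
  kfree_gcd R k n (count id (east_steps n t)).
Proof.
move=> h n0; rewrite /visit_indicator /kfree_gcd walkE // indicE.
have := count_predC id (east_steps n t); rewrite size_mkseq.
rewrite (_ : count (predC id) _ = count negb (east_steps n t)); last first.
  by apply: eq_count.
move: (count id _) (count negb _) => x y xyn.
rewrite -xyn gcdnDl; congr (_%:R); congr nat_of_bool.
apply/idP/asboolP; rewrite inE /kfree_point /=; first by case.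
move=> kf; split => //; apply/eqP => -[x0 y0].
by move: n0; rewrite -xyn x0 y0.
Qed.

End CoinTosses.

Unset Implicit Arguments.

Theorem theorem1p1 (R : realType) (d : measure_display) (T : measurableType d)
    (P : probability T R) (alpha : R) (halpha0 : 0 < alpha)
    (halpha1 : alpha < 1) (k : nat) (hk : (1 <= k)%N)
    (xi : nat -> {RV P >-> (int * int)%type}) (hxi : alpha_steps P alpha xi) :
  {ae P, forall t : T,
    visit_average R k (walk (fun i => xi i)) n t @[n --> \oo]
      --> (1 / zeta (2 * k)%N%:R : R)}.
Proof.
have [C hC] := second_moment_eighth_power hk halpha0 halpha1.
pose F m s := (total_fluctuation R k (m.+1 ^ 8) s / (m.+1 ^ 8)%N%:R) ^+ 2.
have cC : cvgn (series (fun m => C * dirichlet_term R 2 m)).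
  by apply: is_cvg_seriesZ; exact: is_cvg_series_dirichlet.
have F0 m u : 0 <= F m u by exact: sqr_ge0.
apply: filterS2 (ae_unit_step hxi) (ae_cvg0_of_toss_mean hxi F0 hC cC).
move=> t unit_steps.
pose y i : R :=
  kfree_gcd R k i (count id (east_steps xi i t)) - kfree_density R k i.
have totalE n : total_fluctuation R k n (east_steps xi n t) =
    \sum_(1 <= i < n.+1) y i.
  rewrite /total_fluctuation big_nat_cond [RHS]big_nat_cond.
  apply: eq_bigr => i /andP[/andP[_ iN] _].
  rewrite /fluctuation /y /east_steps /mkseq -map_take take_iota.
  by rewrite (minn_idPl _).
move=> hF.
(* The square root undoes the square whose mean was summed. *)
have sparse : (\sum_(1 <= i < (m.+1 ^ 8).+1) y i) / (m.+1 ^ 8)%N%:R @[m --> \oo]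
    --> (0 : R).
  have : Num.sqrt (F m (east_steps xi (m.+1 ^ 8) t)) @[m --> \oo]
      --> Num.sqrt 0.
    by apply: continuous_cvg hF; exact: sqrt_continuous.
  rewrite sqrtr0 => h; apply/norm_cvg0P; apply: cvg_trans h.
  apply: near_eq_cvg; near=> m.
  by rewrite /F sqrtr_sqr totalE.
have mean0 := sparse_means_cvg0 (isT : (0 < 8)%N) _ sparse.
have y1 i : (0 < i)%N -> `|y i| <= 1.
  move=> i0; have := norm_fluctuation_le1 R hk (east_steps xi i t) i0.
  by rewrite /fluctuation take_oversize // size_mkseq.
have -> : (fun n => visit_average R k (walk (fun i => xi i)) n t) =
    fun n => (\sum_(1 <= i < n.+1) y i) / n%:R
             + (\sum_(1 <= i < n.+1) kfree_density R k i) / n%:R.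
  apply/funext => n; rewrite -mulrDl -big_split /= /visit_average.
  congr (_ / _); apply: eq_big_nat => i /andP[i0 _].
  by rewrite /y subrK visit_indicatorE.
have := cvgD (mean0 y1) (@cvg_mean_kfree_density R k hk).
by rewrite add0r; exact.
Unshelve. all: by end_near. Qed.
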